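(* Let $G$ be a (topologically) finitely generated prosolvable group. If the derived subgroup of $G$ is pronilpotent, then $c_n(G)$ is polynomially bounded, i.e. there exists $\beta$, independent of $n$, such that $c_n(G)\le n^\beta$ for every positive integer $n$.
   Context: $c_n(G)$ denotes the number of open subgroups of $G$ of index $n$ which are intersections of (open) maximal subgroups of $G$. As usual for profinite groups, the derived subgroup is the closed subgroup topologically generated by the commutators. *)

(* Defs.v *)
(* MathComp / MathComp-Analysis *)
From HB Require Import structures.
From mathcomp Require Import all_boot all_order all_fingroup all_solvable.
From mathcomp Require Import all_classical topology.

Set Implicit Arguments.
Unset Strict Implicit.
Unset Printing Implicit Defensive.

Local Open Scope classical_set_scope.
Local Open Scope card_scope.
Local Open Scope group_scope.

HB.mixin Record Group_isTopologicalGroup G & monoid.Group G & Topological G := {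
  mulg_continuous : continuous (fun p : G * G => p.1 * p.2);
  invg_continuous : continuous (fun x : G => x^-1)
}.

#[short(type="topologicalGroupType")]
HB.structure Definition TopologicalGroup :=
  { G of monoid.Group G & Topological G & Group_isTopologicalGroup G }.

Definition is_subgroup (G : groupType) (H : set G) : Prop :=
  group_closed (mem H).

Definition generated_subgroup (G : groupType) (X : set G) : set G :=
  smallest (@is_subgroup G) X.

(* The set of left cosets of H is in bijection with {0, ..., n - 1}. *)
Definition has_index (G : groupType) (H : set G) (n : nat) : Prop :=
  range (fun x : G => [set x * h | h in H]) #= `I_n.

Lemma is_subgroup_generated (G : groupType) (X : set G) :
  is_subgroup (generated_subgroup X).
Proof.
split=> [|x y xX yX].
  by apply/mem_set => A [[+ _] _] => /set_mem.
apply/mem_set => A AX; have [[_ AV] _] := AX.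
by apply/set_mem/AV; apply/mem_set; [move/set_mem: xX|move/set_mem: yX]; apply.
Qed.

Section TopologicalGroupTheory.
Context (G : topologicalGroupType).
Implicit Types H : set G.

Lemma continuous_mulg (X : topologicalType) (f g : X -> G) :
  continuous f -> continuous g -> continuous (fun x => f x * g x).
Proof.
move=> cf cg x.
have h := @mulg_continuous G (f x, g x).
exact: (@continuous2_cvg _ _ _ _ _ _ f g (fun a b : G => a * b) _ _ h
          (cf x) (cg x)).
Qed.

Lemma continuous_invg (X : topologicalType) (f : X -> G) :
  continuous f -> continuous (fun x => (f x)^-1).
Proof.
by move=> cf x; apply: continuous_cvg; [exact: invg_continuous|exact: cf].
Qed.

Lemma continuous_divg : continuous (fun p : G * G => p.1 * p.2^-1).
Proof.
apply: continuous_mulg; first by move=> p; exact: cvg_fst.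
by apply: continuous_invg => p; exact: cvg_snd.
Qed.

Lemma is_subgroup_closure H : is_subgroup H -> is_subgroup (closure H).
Proof.
move=> [H1 HV]; split=> [|x y /set_mem xH /set_mem yH].
  by apply/mem_set/subset_closure/set_mem.
apply/mem_set => U /(@continuous_divg (x, y)) [[A B] /= [xA yB] ABU].
have [a [/mem_set Ha Aa]] := xH _ xA; have [b [/mem_set Hb Bb]] := yH _ yB.
exists (a * b^-1); split; first exact/set_mem/HV.
exact: (ABU (a, b)).
Qed.

End TopologicalGroupTheory.

Record subgroup (G : groupType) := Subgroup {
  subgroup_set :> set G;
  subgroupP : is_subgroup subgroup_set
}.

(* A subgroup as a topological group of its own, with the subspace topology. *)
Definition subgroup_type (G : groupType) (H : subgroup G) : Type :=
  set_type (subgroup_set H).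

Section SubgroupType.
Context (G : topologicalGroupType) (H : subgroup G).
Local Notation HT := (subgroup_type H).

HB.instance Definition _ := SubChoice.on HT.
HB.instance Definition _ := Topological.copy HT (set_type (subgroup_set H)).
HB.instance Definition _ :=
  SubChoice_isSubGroup.Build G (mem (subgroup_set H)) HT (subgroupP H).

Let val_continuous : continuous (fun x : HT => \val x : G).
Proof. exact: initial_continuous. Qed.

Let mulg_continuous_HT : continuous (fun p : HT * HT => p.1 * p.2).
Proof.
apply: (@continuous_comp_initial _ _ _ set_val).
apply: (@continuous_mulg G _ (fun p : HT * HT => \val p.1)
                             (fun p : HT * HT => \val p.2)) => p.
  by apply: continuous_cvg; [exact: val_continuous|exact: cvg_fst].
by apply: continuous_cvg; [exact: val_continuous|exact: cvg_snd].
Qed.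

Let invg_continuous_HT : continuous (fun x : HT => x^-1).
Proof.
apply: (@continuous_comp_initial _ _ _ set_val).
exact: (@continuous_invg G _ (fun x : HT => \val x)).
Qed.

HB.instance Definition _ :=
  Group_isTopologicalGroup.Build HT mulg_continuous_HT invg_continuous_HT.

End SubgroupType.

Record inverse_system := InverseSystem {
  isys_disp : Order.disp_t;
  isys_index : porderType isys_disp;
  isys_index0 : isys_index;
  isys_directed : forall i j : isys_index, exists k, (i <= k)%O && (j <= k)%O;
  isys_group : isys_index -> finGroupType;
  isys_map : forall i j : isys_index,
    (i <= j)%O -> {multiplicative isys_group j -> isys_group i};
  isys_map_id : forall (i : isys_index) (ii : (i <= i)%O), isys_map ii =1 id;
  isys_map_comp : forall (i j k : isys_index)
      (ij : (i <= j)%O) (jk : (j <= k)%O) (ik : (i <= k)%O),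
    isys_map ij \o isys_map jk =1 isys_map ik
}.

Definition isys_prod (S : inverse_system) : topologicalType :=
  prod_topology (fun i : isys_index S => discrete_topology (isys_group i)).

Definition inverse_limit (S : inverse_system) : set (isys_prod S) :=
  [set x | forall (i j : isys_index S) (ij : (i <= j)%O),
             isys_map ij (x j) = x i].
Arguments inverse_limit : clear implicits.

(* The last clause, G carrying the initial topology of phi, makes phi a
   homeomorphism onto the inverse limit, a subspace of the product of the
   discrete finite groups. *)
Definition isomorphic_to_limit (G : topologicalGroupType) (S : inverse_system)
    : Prop :=
  exists phi : G -> isys_prod S,
    [/\ forall (i : isys_index S) (x y : G),
          phi (x * y) i = (phi x i : isys_group i) * phi y i,
        set_bij [set: G] (inverse_limit S) phi
      & open = [set phi @^-1` U | U in open] ].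

(* The transition maps of S need not be surjective. *)
Definition pro (C : finGroupType -> Prop) (G : topologicalGroupType) : Prop :=
  exists S : inverse_system,
    (forall i : isys_index S, C (isys_group i)) /\ isomorphic_to_limit G S.

Definition prosolvable : topologicalGroupType -> Prop :=
  pro (fun Q => solvable [set: Q]%G).

Definition pronilpotent : topologicalGroupType -> Prop :=
  pro (fun Q => nilpotent [set: Q]%G).

Section ProfiniteNotions.
Context (G : topologicalGroupType).

Definition topologically_generated (X : set G) : subgroup G :=
  Subgroup (is_subgroup_closure (is_subgroup_generated X)).

Definition topologically_finitely_generated : Prop :=
  exists X : set G,
    finite_set X /\ topologically_generated X = [set: G] :> set G.

Definition derived_subgroup : subgroup G :=
  topologically_generated [set [~ x, y] | x in [set: G] & y in [set: G]].

Definition open_maximal_subgroup (M : set G) : Prop :=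
  [/\ is_subgroup M, open M, M <> [set: G]
    & forall K : set G, is_subgroup K -> M `<=` K -> K = M \/ K = [set: G] ].

(* The family F may be empty, in which case the intersection is G itself. *)
Definition c_subgroups (n : nat) : set (set G) :=
  [set H | [/\ is_subgroup H, open H, has_index H n
     & exists F : set (set G),
         F `<=` open_maximal_subgroup /\ H = \bigcap_(M in F) M ] ].

End ProfiniteNotions.
Arguments c_subgroups : clear implicits.

(* Main.v *)
(* Finitely many subgroups counted by c_n(G) all contain the kernel of one
   projection of G onto a finite group Q, so it suffices to bound, uniformly
   over finite d-generated groups Q with D = Q' nilpotent, the subgroups H of
   index at most n that are intersections of maximal subgroups.

   If M is maximal in Q and does not contain D, then M cap D is normal in Q and
   D / (M cap D) is a chief factor V of Q.  The group induced by Q on V is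
   abelian and irreducible, hence cyclic, so V is F_p[X] modulo a
   characteristic polynomial, and M cap D is determined by that polynomial, by
   the action of the generators and by the images in V of their commutators:
   there are at most q^(2 + d + d^2) possibilities with |V| = q.

   The trace K = H cap D is an irredundant intersection of such subgroups, and
   |D : K| is the product of the orders q of the corresponding factors; since
   the sum of (n / q)^2 over the divisors q > 1 of n is at most n^2, the traces
   of index n are at most n^(4 + d + d^2) in number.  Finally Q / D is abelian
   on d generators, so at most n^(2d) subgroups of index at most n have a given
   trace K on D: along a chain from D to Q with d cyclic factors, a subgroup B
   of A_(i+1) is generated by B cap A_i and one element g^j y, where j is at
   most n and y matters only modulo B cap A_i. *)
Require Import Defs.
From HB Require Import structures.
From mathcomp Require Import all_boot all_order all_fingroup all_solvable.
From mathcomp Require Import all_algebra mxrepresentation mxabelem boolp.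
From mathcomp Require Import zify.

Set Implicit Arguments.
Unset Strict Implicit.
Unset Printing Implicit Defensive.

(** * Chief factors under a nilpotent normal subgroup *)

Section ChiefFactors.
Local Open Scope group_scope.
Context (gT : finGroupType).
Implicit Types Q D K L M : {group gT}.

(** By nilpotency [M :&: D] is smaller than its normalizer in [D], so its normalizer in [Q] properly
    contains [M] and is [Q]. For [H] normal in [Q] between [M :&: D] and [D], the join [M <*> H] is
    [M], giving [H = M :&: D], or [Q], giving [H = D] by Dedekind's law. *)
Lemma maximal_capN_chief Q D M :
  D <| Q -> nilpotent D -> maximal M Q -> ~~ (D \subset M) ->
  chief_factor Q (M :&: D) D.
Proof.
move=> nDQ nilD maxM nDM; have /andP[sDQ nD] := nDQ.
have [sMQ _] := andP (maxgroupp maxM).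
have prL : M :&: D \proper D by rewrite properE subsetIr subsetI subxx andbT.
have nLM : M \subset 'N(M :&: D).
  by rewrite normsI ?normG // (subset_trans sMQ).
have maxMP : forall H : {group gT}, M \subset H -> H \subset Q -> H = M \/ H :=: Q.
  move=> H MH; rewrite subEproper => /predU1P[->|pH]; first by right.
  left; apply: group_inj; apply/eqP; rewrite eq_sym eqEsubset MH /=.
  by have /maxgroupP[_ /(_ H pH MH) ->] := maxM.
have MDQ : M * D = Q.
  rewrite -norm_joinEl ?(subset_trans sMQ) //.
  have [||E|//] := maxMP (M <*> D)%G; rewrite ?joing_subl ?join_subG ?sMQ //.
  by case/negP: nDM; have /= <- := congr1 val E; apply: joing_subr.
have nLQ : Q \subset 'N(M :&: D).
  have [||EM|<-] := maxMP ('N_Q(M :&: D))%G; last exact: subsetIr.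
  - by rewrite subsetI sMQ.
  - exact: subsetIl.
  have /properP[_ [x /setIP[Dx Nx]]] := nilpotent_proper_norm nilD prL.
  rewrite inE Dx andbT -EM /= => /negP[]; rewrite inE Nx andbT.
  exact: (subsetP sDQ).
rewrite /chief_factor nDQ andbT; apply/maxgroupP; split; first by rewrite prL.
move=> H /andP[pH nHQ] LH; have sHD := proper_sub pH.
have nHM : M \subset 'N(H) := subset_trans sMQ nHQ.
have [||E|E] := maxMP (M <*> H)%G.
- exact: joing_subl.
- by rewrite join_subG sMQ (subset_trans sHD).
- apply/eqP; rewrite eqEsubset LH subsetI sHD !andbT /=.
  by have /= <- := congr1 val E; apply: joing_subr.
case/andP: pH => _ /negP[]; rewrite -(setIidPl (_ : D \subset M * H)).
  by rewrite -group_modr // setIC mulSGid // LH.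
by rewrite -norm_joinEl // [M <*> H]E.
Qed.

Inductive chief_meet Q D : {group gT} -> Prop :=
| chief_meet_top : chief_meet Q D D
| chief_meetI K L : chief_meet Q D K -> chief_factor Q L D ->
    ~~ (K \subset L) -> chief_meet Q D (K :&: L)%G.

Lemma chief_meet_normal Q D K : D <| Q -> chief_meet Q D K ->
  K \subset D /\ K <| Q.
Proof.
move=> nDQ; elim=> {K} [|K L _ [sKD nKQ] /andP[/maxgroupp/andP[pL nLQ] _] _].
  by [].
split; first by rewrite subIset ?sKD.
rewrite normalI // /normal nLQ (subset_trans (proper_sub pL)) //.
exact: normal_sub.
Qed.

(** [K <*> L] is normalized by [Q] and larger than [L], hence equal to [D] by maximality. *)
Lemma index_chief_meetI Q D K L : D <| Q -> chief_meet Q D K ->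
  chief_factor Q L D -> ~~ (K \subset L) ->
  #|D : K :&: L| = (#|D : K| * #|D : L|)%N.
Proof.
move=> nDQ mK chL nKL; have [sKD nKQ] := chief_meet_normal nDQ mK.
have /andP[/maxgroupP[/andP[pL nLQ] maxL] _] := chL; have sLD := proper_sub pL.
have nLK : K \subset 'N(L) := subset_trans (normal_sub nKQ) nLQ.
have KLD : K * L = D.
  rewrite -norm_joinEl //; apply/eqP.
  have: K <*> L \subset D by rewrite join_subG sKD.
  rewrite subEproper => /orP[//|pKL]; have := maxL (K <*> L)%G.
  rewrite pKL normsY ?(normal_norm nKQ) // joing_subr => /(_ isT isT) E.
  by case/negP: nKL; rewrite -E joing_subl.
rewrite -(Lagrange_index sKD (subsetIl K L)) indexgI; congr (_ * _)%N.
by rewrite -KLD normC // indexMg.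
Qed.

(* Members of [S] that contain the trace reached so far are skipped, so the
   chief factors met are independent and their orders multiply. *)
Lemma chief_meet_bigcap Q D (S : seq {group gT}) :
  D <| Q -> nilpotent D -> {in S, forall M, maximal M Q} ->
  exists2 K : {group gT}, chief_meet Q D K &
    K :=: D :&: \bigcap_(M <- S) M.
Proof.
move=> nDQ nilD; elim: S => [|M S IH] maxS.
  by exists D; rewrite ?big_nil ?setIT //; constructor.
have [|K mK KE] := IH; first by move=> N SN; apply: maxS; rewrite inE SN orbT.
have [sKD _] := chief_meet_normal nDQ mK.
rewrite big_cons; have [sKM|nKM] := boolP (K \subset M).
  by exists K => //; rewrite setICA -KE; apply/esym/setIidPr.
exists (K :&: (M :&: D))%G; last first.
  by rewrite /= [M :&: D]setIC setIA (setIidPl sKD) setICA -KE setIC.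
constructor => //; last by apply: contra nKM; rewrite subsetI => /andP[].
apply: maximal_capN_chief => //; first by apply: maxS; rewrite mem_head.
by apply: contra nKM; apply: subset_trans.
Qed.

End ChiefFactors.

(** * Subgroups with a given trace *)

Lemma leq_card_bigcup (I T : finType) (A : {set I}) (F : I -> {set T}) :
  #|\bigcup_(i in A) F i| <= \sum_(i in A) #|F i|.
Proof.
elim/big_rec2: _ => [|i m B _ le_m]; first by rewrite cards0.
by rewrite (leq_trans (leq_card_setU _ _)) // leq_add2l.
Qed.

Section TraceCount.
Local Open Scope group_scope.
Context (gT : finGroupType).
Implicit Types A B D K Q : {group gT}.

Definition traces (D K A : {group gT}) (k : nat) : {set {group gT}} :=
  [set B : {group gT} | [&& B \subset A, B :&: D == K & #|A : B| <= k]].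

(** The image of [B] in the cyclic quotient is generated by the power of [g] whose exponent [j] is
    its index; [z] is a lift of that power to [B]. *)
Lemma cyclic_extension_gen A1 A g B : A1 <| A -> A / A1 = <[coset A1 g]> ->
  g \in A -> B \subset A ->
  exists2 z, z \in B & exists2 j, 0 < j <= #|A : B| &
    z \in g ^+ j *: A1 /\ B :=: <<(B :&: A1) :|: [set z]>>.
Proof.
move=> nA1A defA Ag sBA; have sA1A := normal_sub nA1A.
have nA1 := subsetP (normal_norm nA1A).
have sBX : B / A1 \subset <[coset A1 g]> by rewrite -defA quotientS.
pose j := #|<[coset A1 g]> : B / A1|.
have j_dvd : j %| #[coset A1 g] by apply: dvdn_indexg.
have EB : <[coset A1 g ^+ j]> = B / A1.
  apply/eqP; rewrite (eq_subG_cyclic (cycle_cyclic (coset A1 g))) ?cycleX //.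
  by rewrite -[#|<[_]>|]/#[_] orderXdiv // divg_indexS.
have Bgj : coset A1 (g ^+ j) \in B / A1.
  by rewrite morphX ?nA1 // -EB cycle_id.
have [z Nz Bz Ez] := morphimP Bgj.
exists z => //; exists j.
  rewrite indexg_gt0 /= dvdn_leq ?indexg_gt0 //.
  rewrite /j -defA; apply: index_quotient.
  by rewrite (subset_trans (subsetIl _ _)) // normal_norm.
have zA1 : z \in g ^+ j *: A1.
  have Ngj : g ^+ j \in 'N(A1) by rewrite groupX ?nA1.
  rewrite mem_lcoset; apply: coset_idr; first by rewrite groupM ?groupV.
  by rewrite morphM ?groupV // morphV // -Ez mulVg.
split=> //; apply/eqP; rewrite eqEsubset gen_subG subUset subsetIl sub1set Bz !andbT.
apply/subsetP => b Bb.
have : coset A1 b \in <[coset A1 z]>.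
  by rewrite -Ez morphX ?nA1 // EB mem_quotient.
case/cycleP => m Em; have Nb : b \in 'N(A1) by rewrite nA1 ?(subsetP sBA).
have bzA1 : b * z ^- m \in A1.
  apply: coset_idr; first by rewrite groupM ?groupV ?groupX.
  by rewrite morphM ?groupV ?groupX // morphV ?groupX // morphX // -Em mulgV.
rewrite -(mulgKV (z ^+ m) b) groupM ?groupX ?mem_gen ?inE ?eqxx ?orbT //.
by rewrite bzA1 groupM ?groupV ?groupX.
Qed.

(** [B] is recovered from [B :&: A1], the exponent [j] and the coset of [B :&: A1] in [A1] holding
    g^-j z; there are at most [k] choices for each of the last two. *)
Lemma card_traces_cyclic D K A1 A k : A1 <| A -> cyclic (A / A1) ->
  D \subset A1 -> #|traces D K A k| <= #|traces D K A1 k| * (k * k).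
Proof.
move=> nA1A /cyclicP[gb defA] sDA1; have sA1A := normal_sub nA1A.
have [g [Ng Ag gE]] : exists g, [/\ g \in 'N(A1), g \in A & coset A1 g = gb].
  have : gb \in A / A1 by rewrite defA cycle_id.
  by case/morphimP => g Ng Ag ->; exists g.
rewrite -gE in defA.
pose F B1 : {set {group gT}} :=
  [set <<(B1 : {group gT}) :|: [set (g ^+ (p.1 : 'I_k).+1 * repr (p.2 : {set gT}))%g]>>%G
     | p in setX [set: 'I_k] (lcosets B1 A1)].
have sub : traces D K A k \subset \bigcup_(B1 in traces D K A1 k) F B1.
  apply/subsetP => B; rewrite inE => /and3P[sBA /eqP BD iB].
  have [z Bz [j /andP[j0 jB] [/lcosetP[a A1a zE] BE]]] :=
    cyclic_extension_gen nA1A defA Ag sBA.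
  apply/bigcupP; exists (B :&: A1)%G.
    rewrite inE subsetIr /= -setIA (setIidPr sDA1) BD eqxx /=.
    apply: leq_trans iB; rewrite setIC indexgI.
    exact/subset_leq_card/imsetS.
  have jk : j.-1 < k by rewrite prednK // (leq_trans jB).
  apply/imsetP; exists (Ordinal jk, a *: (B :&: A1)).
    rewrite !inE /=; apply/lcosetsP; exists a => //.
  apply: group_inj; rewrite /= prednK //.
  (* Changing the representative multiplies [z] by some [b] in [B :&: A1], which leaves the
     generated group unchanged. *)
  have /lcosetP[b /setIP[Bb A1b] ->] : repr (a *: (B :&: A1)) \in a *: (B :&: A1).
    by apply: (mem_repr a); apply: lcoset_refl.
  rewrite mulgA -zE {1}BE; apply/eqP; rewrite eqEsubset !gen_subG !subUset !sub1set.
  rewrite !sub_gen ?subsetUl //=; apply/andP; split.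
    rewrite -[X in X \in _](mulgK b z) groupM // ?groupV mem_gen // !inE.
      by rewrite eqxx orbT.
    by rewrite Bb A1b.
  by rewrite groupM ?mem_gen ?inE ?eqxx ?orbT // Bb A1b.
apply: leq_trans (subset_leq_card sub) _; apply: leq_trans (leq_card_bigcup _ _) _.
rewrite -sum_nat_const leq_sum // => B1; rewrite inE => /and3P[_ _ iB1].
rewrite (leq_trans (leq_imset_card _ _)) // cardsX cardsT card_ord card_lcosets.
by rewrite leq_mul2l iB1 orbT.
Qed.

(** Adjoining the generators one by one gives a chain of cyclic extensions, normal because each term
    contains the derived subgroup of [Q]. *)
Lemma card_traces D K Q (s : seq gT) k : Q^`(1) \subset D -> D \subset Q ->
  {subset s <= Q} ->
  #|traces D K (D <*> <<[set x in s]>>) k| <= k ^ (size s).*2.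
Proof.
move=> Q'D sDQ; elim: s => [|x s IH] sQ.
  have -> : (D <*> <<[set x in [::]]>>)%G = D.
    by apply: group_inj; rewrite /= set_nil gen0 joingG1.
  apply: (@leq_trans #|[set K]|); last by rewrite cards1.
  apply/subset_leq_card/subsetP => B; rewrite !inE => /and3P[sBD /eqP BD _].
  by apply/eqP/group_inj; rewrite -BD (setIidPl sBD).
have {}IH : #|traces D K (D <*> <<[set x in s]>>) k| <= k ^ (size s).*2.
  by apply: IH => y sy; apply: sQ; rewrite inE sy orbT.
have Qx : x \in Q by apply: sQ; rewrite mem_head.
set A1 := (D <*> <<[set y in s]>>)%G in IH *.
set A := (D <*> _)%G.
have sAQ : A \subset Q.
  rewrite /A /= join_subG sDQ gen_subG; apply/subsetP => y; rewrite inE; exact: sQ.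
have sDA1 : D \subset A1 := joing_subl _ _.
have AE : A :=: A1 <*> <[x]>.
  by rewrite /= -joingA; congr (_ <*> _); rewrite set_cons setUC joing_idl joing_idr.
have nA1A : A1 <| A.
  apply: sub_der1_normal; last by rewrite AE joing_subl.
  exact: subset_trans (dergS 1 sAQ) (subset_trans Q'D sDA1).
have nxA1 : <[x]> \subset 'N(A1).
  by apply: subset_trans (normal_norm nA1A); rewrite AE joing_subr.
have cycA : cyclic (A / A1).
  by rewrite AE quotientYidl // quotient_cyclic ?cycle_cyclic.
apply: leq_trans (card_traces_cyclic K k nA1A cycA sDA1) _.
by rewrite doubleS !expnS [X in _ <= X]mulnA [X in _ <= X]mulnC leq_mul.
Qed.

End TraceCount.

(** * Counting intersections by index *)

Lemma sum_sqr_codivisors n :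
  \sum_(q < n.+1 | (1 < q) && (q %| n)) (n %/ q) ^ 2 <= n ^ 2.
Proof.
case: n => [|n]; first by rewrite big_mkcond big_ord_recl big_ord0.
(* As 1/q^2 <= 1/(q - 1) - 1/q, the sum up to [N] telescopes with remainder [m ^ 2 %/ N]. *)
set m := n.+1; have tele N : 0 < N ->
    \sum_(q < N.+1 | (1 < q) && (q %| m)) (m %/ q) ^ 2 + m ^ 2 %/ N <= m ^ 2.
  elim: N => // -[|N] IH _.
    by rewrite big_mkcond !big_ord_recr big_ord0 /= divn1.
  apply: leq_trans (IH isT); rewrite big_mkcond [X in _ <= X + _]big_mkcond /=.
  rewrite big_ord_recr /= -addnA leq_add2l.
  case: ifP => [/dvdnP[j jE]|_]; last by rewrite leq_div2l.
  rewrite jE mulnK // expnMn -[N.+2 ^ 2]mulnn mulnA mulnK // leq_divRL //.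
  nia.
by apply: leq_trans (tele m isT); rewrite leq_addr.
Qed.

Section ChiefCount.
Local Open Scope group_scope.
Context (gT : finGroupType) (Q D : {group gT}) (c : nat).
Hypothesis nDQ : D <| Q.
Hypothesis card_chief : forall q : nat,
  #|[set L : {group gT} | chief_factor Q L D & #|D : L| == q]| <= q ^ c.

(** Splitting off the last chief factor, of order q, bounds the count by the sum of (n/q)^(c+2) q^c
    = n^c (n/q)^2; the extra 2 in the exponent pays for the sum over q. *)
Lemma card_chief_meet n : 0 < n ->
  #|[set K : {group gT} | `[< chief_meet Q D K >] & #|D : K| == n]| <= n ^ (c + 2).
Proof.
have [m] := ubnP n; elim: m n => // m IH n; rewrite ltnS => le_nm n_gt0.
pose S (n : nat) := [set K : {group gT} | `[< chief_meet Q D K >] & #|D : K| == n].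
pose C (n : nat) := [set L : {group gT} | chief_factor Q L D & #|D : L| == n].
have [n_le1|n_gt1] := leqP n 1.
  have -> : n = 1%N by apply/eqP; rewrite eqn_leq n_le1.
  rewrite exp1n; apply: (@leq_trans #|[set D]|); last by rewrite cards1.
  apply/subset_leq_card/subsetP => K; rewrite !inE => /andP[/asboolP mK iK].
  have [sKD _] := chief_meet_normal nDQ mK.
  by apply/eqP/group_inj/eqP; rewrite eqEsubset sKD -indexg_eq1.
pose A := [set q : 'I_n.+1 | (1 < q) && (q %| n)]%N.
pose F (q : 'I_n.+1) := [set (p.1 :&: p.2)%G | p in setX (S (n %/ q)) (C q)].
have sub : S n \subset \bigcup_(q in A) F q.
  apply/subsetP => K; rewrite inE => /andP[/asboolP mK]; case: mK.
    by rewrite indexgg eq_sym => /eqP n1; rewrite n1 in n_gt1.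
  move=> {}K L mK chL nKL; rewrite (index_chief_meetI nDQ mK chL nKL) => /eqP nE.
  have ltLn : #|D : L| < n.+1 by rewrite ltnS -nE leq_pmull ?indexg_gt0.
  apply/bigcupP; exists (Ordinal ltLn).
    rewrite inE /= -nE dvdn_mull // andbT indexg_gt1.
    by have /andP[/maxnormal_proper/andP[]] := chL.
  apply/imsetP; exists (K, L); last by [].
  rewrite 2!inE /= !inE chL eqxx -nE mulnK ?indexg_gt0 // eqxx !andbT.
  exact/asboolP.
apply: leq_trans (subset_leq_card sub) _; apply: leq_trans (leq_card_bigcup _ _) _.
rewrite expnD mulnC; apply: leq_trans (leq_mul (sum_sqr_codivisors n) (leqnn _)).
rewrite big_distrl /= [X in X <= _]big_mkcond [X in _ <= X]big_mkcond /=.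
apply: leq_sum => q _; rewrite inE; case: ifP => // /andP[q_gt1 q_dvd].
apply: leq_trans (leq_imset_card _ _) _; rewrite cardsX.
have q_gt0 : (0 < q)%N := ltnW q_gt1.
have nq_gt0 : (0 < n %/ q)%N.
  by rewrite (divn_gt0 _ q_gt0) (dvdn_leq n_gt0 q_dvd).
have lt_nq : (n %/ q < m)%N := leq_trans (ltn_Pdiv q_gt1 n_gt0) le_nm.
have leS := IH _ lt_nq nq_gt0; have leC := card_chief q.
apply: leq_trans (leq_mul leS leC) _.
by rewrite expnD mulnAC -expnMn divnK // mulnC.
Qed.

End ChiefCount.

(** * Irreducible modules of abelian groups *)

Section CyclicModule.
Local Open Scope ring_scope.
Import GRing.Theory.

(** An abelian group acting faithfully and irreducibly is cyclic, so one operator [B] generates the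
    action. Any nonzero vector is then cyclic for [B], and each [rG x] becomes multiplication by a
    power of X modulo the characteristic polynomial. *)
Lemma mx_irr_abelian_poly (F : fieldType) (gT : finGroupType)
    (G : {group gT}) (n' : nat) (rG : mx_representation F G n'.+1) :
  mx_irreducible rG -> abelian (G / rker rG)%g ->
  exists chi : {poly F}, exists2 P : 'M_n'.+1, P \in unitmx &
    size chi = n'.+2 /\
    forall x, x \in G -> exists h : 'rV_n'.+1, forall y : 'rV_n'.+1,
      y *m P *m rG x = poly_rV ((rVpoly y * rVpoly h) %% chi) *m P.
Proof.
set n := n'.+1 => irrG abG.
have [b Gb bX] : exists2 b, b \in G &
    forall x, x \in G -> exists k, rG x = rG b ^+ k.
  have : cyclic (G / rker rG)%g.
    apply: mx_faithful_irr_abelian_cyclic (kquo_mx_faithful rG) _ abG.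
    exact/quo_mx_irr.
  case/cyclicP => bb defG.
  have : bb \in (G / rker rG)%g by rewrite defG cycle_id.
  case/morphimP => b Nb Gb bbE; exists b => // x Gx.
  have : coset (rker rG) x \in <[bb]>%g by rewrite -defG mem_quotient.
  case/cycleP => k xE; exists k.
  rewrite -(kquo_repr_coset rG Gx) xE bbE -morphX //.
  by rewrite kquo_repr_coset ?groupX // repr_mxX.
set B := rG b in bX; pose chi := char_poly B.
have szchi : size chi = n.+1 by rewrite size_char_poly.
have chi0 : chi != 0 by rewrite -size_poly_eq0 szchi.
have szmod a : (size (a %% chi)%R <= n)%N by rewrite -ltnS -szchi ltn_modp.
pose v0 : 'rV[F]_n := delta_mx 0 0.
pose P := powers_mx B n *m lin_mul_row v0.
have PE (y : 'rV_n) : y *m P = v0 *m horner_mx B (rVpoly y).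
  by rewrite mulmxA mul_rV_lin1 /= horner_rVpoly.
have PmodE a : v0 *m horner_mx B a = poly_rV (a %% chi) *m P.
  rewrite PE poly_rV_K // {1}(divp_eq a chi) rmorphD rmorphM /=.
  by rewrite Cayley_Hamilton mulr0 add0r.
exists chi, P; last first.
  split=> // x Gx; have [k xE] := bX x Gx; exists (poly_rV ('X^k %% chi)) => y.
  rewrite poly_rV_K // modp_mul -PmodE PE rmorphM rmorphXn /= horner_mx_X.
  by rewrite -mulmxA xE.
(* The row space of [P] is a nonzero submodule, hence everything. *)
rewrite -row_full_unit; have [_ ->//] := (mx_irrP rG).1 irrG.
  apply/mxmoduleP => x Gx; have [k ->] := bX x Gx; apply/row_subP => i.
  rewrite row_mul rowE PE -mulmxA -{2}[B]horner_mx_X -rmorphXn /= mulmxE -rmorphM.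
  by rewrite PmodE submxMl.
apply/eqP => P0; have := PmodE 1; rewrite P0 mulmx0 rmorph1 mulmx1.
by move/matrixP/(_ 0 0)/eqP; rewrite !mxE !eqxx oner_eq0.
Qed.

End CyclicModule.

(** * Counting chief factors by codes *)

Section ChiefCode.
Context (gT : finGroupType) (d : nat) (Q : {group gT}) (g : 'I_d -> gT).
Hypothesis defQ : Q :=: <<[set g i | i in 'I_d]>>%g.
Let D : {group gT} := Q^`(1)%G.
Hypothesis solD : solvable D.
Implicit Types L : {group gT}.

Let Qg i : g i \in Q.
Proof. by rewrite defQ mem_gen // imset_f. Qed.

Let nDQ : (D <| Q)%g.
Proof. exact: der_normal. Qed.

(** The form [.-1.+1] agrees with the dimension in [abelem_rV] and is visibly positive. *)
Let dim (q : nat) := (logn (pdiv q) q).-1.+1.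

(* The chief factor [D / L] of order [q] is cyclic as a module over a single
   operator: [c.1.1] is the characteristic polynomial of that operator, [c.1.2]
   lists polynomials giving the action of the generators, and [c.2] lists the
   coordinates of the commutators of the generators. *)
Let code (q : nat) : finType :=
  ('rV['F_(pdiv q)]_(dim q).+1 * {ffun 'I_d -> 'rV['F_(pdiv q)]_(dim q)} *
   {ffun 'I_d * 'I_d -> 'rV['F_(pdiv q)]_(dim q)})%type.

Let coded (q : nat) L (c : code q) : Prop :=
  exists pi : gT -> 'rV['F_(pdiv q)]_(dim q),
  [/\ {in D &, {morph pi : x y / (x * y)%g >-> (x + y)%R}},
      L \subset D /\ {in D, forall x, (x \in L) = (pi x == 0%R)},
      forall i, {in D, forall x, pi (x ^ g i)%g =
        poly_rV ((rVpoly (pi x) * rVpoly (c.1.2 i)) %% rVpoly c.1.1)%R}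
    & forall i j, pi [~ g i, g j]%g = c.2 (i, j)].

(** [D / L] is minimal normal and solvable, hence elementary abelian; it acts trivially on itself,
    so [Q] induces an abelian irreducible group on it. *)
Let coded_exists L : chief_factor Q L D -> exists c : code #|(D / L)%g|, coded L c.
Proof.
move=> chL; have /andP[/maxgroupp/andP[pLD nLQ] _] := chL.
have sLD := proper_sub pLD.
have sDQ := normal_sub nDQ.
have nLD : D \subset 'N(L)%g := subset_trans sDQ nLQ.
have minE := chief_factor_minnormal chL.
have [nEG ntE abelE] := minnormal_solvable minE (subxx _) (quotient_sol L solD).
rewrite /is_abelem in abelE.
set q := #|_| in abelE *.
pose rV := abelem_rV abelE ntE; pose rG := abelem_repr abelE ntE nEG.
have irrG : mx_irreducible rG by apply/abelem_mx_irrP.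
have abG : abelian ((Q / L) / rker rG)%g.
  apply: sub_der1_abelian; rewrite /rG /= rker_abelem -quotient_der //.
  rewrite subsetI quotientS //; exact: abelem_abelian abelE.
have [chi [P Punit [szchi chiP]]] := mx_irr_abelian_poly irrG abG.
have [h hE] : exists h : {ffun 'I_d -> 'rV['F_(pdiv q)]_(dim q)}, forall i y,
    (y *m P *m rG (coset L (g i)) =
     poly_rV ((rVpoly y * rVpoly (h i)) %% chi) *m P)%R.
  have ex i := chiP _ (mem_quotient L (Qg i)).
  exists [ffun i => sval (cid (ex i))] => i y; rewrite ffunE.
  by case: (cid (ex i)).
pose pi x := (rV (coset L x) *m invmx P)%R.
exists (poly_rV chi, h, [ffun ij => pi [~ g ij.1, g ij.2]%g]).
have ED x : x \in D -> coset L x \in (D / L)%g by apply: mem_quotient.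
exists pi; split=> [x y Dx Dy||i x Dx|i j]; last by rewrite ffunE.
- rewrite /pi morphM ?(subsetP nLD) // /rV abelem_rV_M ?ED //.
  by rewrite mulmxDl.
- split=> // x Dx; rewrite /pi; apply/idP/eqP => [Lx|].
    by rewrite coset_id // /rV abelem_rV_1 mul0mx.
  move/(congr1 (mulmx^~ P)); rewrite mulmxKV // mul0mx => rV0.
  apply: coset_idr; first exact: (subsetP nLD).
  apply: (@abelem_rV_inj _ _ _ abelE ntE _ _ (ED x Dx) (group1 _)).
  by rewrite abelem_rV_1.
have Qgi := subsetP nLQ _ (Qg i).
rewrite /= [rVpoly (poly_rV chi)]poly_rV_K ?szchi // /pi.
have NLx := subsetP nLD x Dx.
rewrite morphJ // /rV (abelem_rV_J abelE ntE nEG) ?ED ?mem_quotient //.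
by rewrite -[X in (X *m _ *m _)%R = _](mulmxKV Punit) hE mulmxK.
Qed.

(** The subgroup of [D] where both projections agree is normalized by the generators, which act
    alike, and contains their commutators. So [Q] is abelian modulo it, and it is all of [D]. *)
Let coded_inj q L1 L2 c : @coded q L1 c -> coded L2 c -> L1 = L2.
Proof.
case=> pi1 [pi1M [sL1 L1E] pi1J pi1g] [pi2 [pi2M [sL2 L2E] pi2J pi2g]].
suff eq_pi : {in D, pi1 =1 pi2}.
  apply: group_inj; apply/setP => x; have [Dx|nDx] := boolP (x \in D).
    by rewrite L1E // L2E // eq_pi.
  by apply/idP/idP => [/(subsetP sL1)|/(subsetP sL2)]; rewrite (negPf nDx).
have pi1_1 : (pi1 1%g = 0)%R.
  apply: (@GRing.addrI _ (pi1 1%g)); by rewrite -pi1M ?mulg1 ?GRing.addr0 ?group1.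
have pi2_1 : (pi2 1%g = 0)%R.
  apply: (@GRing.addrI _ (pi2 1%g)); by rewrite -pi2M ?mulg1 ?GRing.addr0 ?group1.
pose T := [set x in D | pi1 x == pi2 x].
have groupT : group_set T.
  apply/group_setP; split; first by rewrite inE group1 pi1_1 pi2_1 /=.
  move=> x y; rewrite !inE => /andP[Dx /eqP Ex] /andP[Dy /eqP Ey].
  by rewrite groupM //= pi1M // pi2M // Ex Ey.
pose TG := Group groupT.
have nTg i : g i \in 'N(TG)%g.
  rewrite inE; apply/subsetP => _ /imsetP[x Tx ->]; move: Tx.
  rewrite !inE => /andP[Dx /eqP Ex].
  by rewrite memJ_norm ?(subsetP (der_norm 1 Q)) // Dx pi1J // pi2J // Ex /=.
have nTA : [set g i | i in 'I_d] \subset 'N(TG)%g.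
  by apply/subsetP => _ /imsetP[i _ ->].
have: D \subset TG.
  apply: der1_min; first by rewrite defQ gen_subG.
  rewrite defQ quotient_gen // abelian_gen /abelian quotient_cents2 //.
  rewrite gen_subG; apply/subsetP => _ /imset2P[_ _ /imsetP[i _ ->] /imsetP[j _ ->] ->].
  by rewrite inE pi1g pi2g eqxx andbT mem_commg.
by move/subsetP => DT x /DT; rewrite inE => /andP[_ /eqP].
Qed.

Lemma card_chief_factors (q : nat) :
  #|[set L : {group gT} | chief_factor Q L Q^`(1)%G & #|Q^`(1) : L|%g == q]|
    <= q ^ (2 + d + d * d).
Proof.
set S := [set L | _ & _].
have [->|[L0 L0S]] := set_0Vmem S; first by rewrite cards0.
have SE L : L \in S -> #|(D / L)%g| = q /\ chief_factor Q L D.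
  rewrite inE => /andP[chL /eqP <-]; split=> //; rewrite card_quotient //.
  have /andP[/maxgroupp/andP[_ nLQ] _] := chL.
  exact: subset_trans (normal_sub nDQ) nLQ.
have [q_pr qE] : prime (pdiv q) /\ q = pdiv q ^ dim q.
  have [<- chL] := SE _ L0S.
  have minE := chief_factor_minnormal chL.
  have [_ ntE abelE] := minnormal_solvable minE (subxx _) (quotient_sol L0 solD).
  have [p_pr _ [n nE]] := pgroup_pdiv (abelem_pgroup abelE) ntE.
  have lE : logn (pdiv #|(D / L0)%g|) #|(D / L0)%g| = n.+1 by rewrite {2}nE pfactorK.
  by rewrite /dim lE -nE.
(* The default is never reached for a code of some [L], and by [coded_inj] the group picked is that
   [L]. *)
pose decode (c : code q) : {group gT} :=
  odflt 1%G [pick L : {group gT} | `[< coded L c >]].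
have sub : S \subset [set decode c | c : code q].
  apply/subsetP => L LS; have [Lq chL] := SE L LS.
  have := coded_exists chL; rewrite Lq => -[c cL].
  apply/imsetP; exists c => //; rewrite /decode.
  case: pickP => [L' /asboolP cL'|/(_ L)/asboolP//]; exact: coded_inj cL cL'.
apply: leq_trans (subset_leq_card sub) _; apply: leq_trans (leq_imset_card _ _) _.
(* There are p q <= q^2 choices for the polynomial, where p is [pdiv q], then q^d actions and q^(d *
   d) commutator tables. *)
rewrite !card_prod !card_ffun !card_prod !card_ord !card_mx !card_Fp // !mul1n.
rewrite expnS -qE !expnD !leq_mul // pdiv_leq //.
by rewrite qE expn_gt0 prime_gt0.
Qed.

End ChiefCode.

(** * The bound for finite groups *)

Definition growth_exponent (d : nat) : nat := 1 + (2 + d + d * d + 2) + d.*2.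

(** The exponent adds 1 for the index of the trace in [D], [2 + d + d * d + 2] for the traces of
    that index and [d.*2] for the subgroups with that trace. *)
Lemma card_maximal_intersections (gT : finGroupType) (d : nat)
    (Q : {group gT}) (g : 'I_d -> gT) (n : nat) (S : {set {group gT}}) :
  Q :=: <<[set g i | i in 'I_d]>>%g -> nilpotent Q^`(1)%g ->
  (forall H, H \in S -> #|Q : H|%g <= n /\
     exists2 F : seq {group gT}, {in F, forall M : {group gT}, maximal M Q} &
       H :=: Q :&: \bigcap_(M <- F) M) ->
  #|S| <= n ^ growth_exponent d.
Proof.
move=> defQ nilD S_P.
pose D := Q^`(1)%G; have nDQ : (D <| Q)%g by apply: der_normal.
have sDQ := normal_sub nDQ.
pose T m := [set K : {group gT} | `[< chief_meet Q D K >] & #|D : K|%g == m].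
have leT m : 0 < m -> #|T m| <= m ^ (2 + d + d * d + 2).
  apply: (card_chief_meet nDQ) => q.
  exact: card_chief_factors defQ (nilpotent_sol nilD) q.
pose U := \bigcup_(m in [set: 'I_n]) T m.+1.
have leU : #|U| <= n ^ (1 + (2 + d + d * d + 2)).
  apply: leq_trans (leq_card_bigcup _ _) _.
  rewrite expnD expn1 -[X in X * _]card_ord -cardsT -sum_nat_const leq_sum // => m _.
  by rewrite (leq_trans (leT _ _)) // leq_exp2r // addn2.
have leTr (K : {group gT}) : #|traces D K Q n| <= n ^ d.*2.
  have -> : Q = (D <*> <<[set x in codom g]>>)%G.
    have sg : <<[set x in codom g]>>%g = Q.
      rewrite defQ; congr <<_>>%g; apply/setP => x; rewrite inE.
      apply/codomP/imsetP => [[i ->]|[i _ ->]]; by exists i.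
    by apply: group_inj; rewrite /= sg; apply/esym/joing_idPr.
  have sz : size (codom g) = d by rewrite size_codom card_ord.
  rewrite -[X in n ^ X.*2]sz.
  apply: (@card_traces _ _ _ Q) => //.
  by move=> _ /codomP[i ->]; rewrite defQ mem_gen // imset_f.
have sub : S \subset \bigcup_(K in U) traces D K Q n.
  apply/subsetP => H /S_P[iH [F maxF HE]].
  have [K mK KE] := chief_meet_bigcap nDQ nilD maxF.
  have HDK : H :&: D = K by rewrite HE KE setIAC (setIidPr sDQ).
  have iK : #|D : K|%g <= n.
    by rewrite -HDK setIC indexgI (leq_trans _ iH) // subset_leq_card ?imsetS.
  apply/bigcupP; exists K.
    have ltK : #|D : K|%g.-1 < n by rewrite prednK ?indexg_gt0.
    apply/bigcupP; exists (Ordinal ltK) => //.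
    by rewrite inE /= prednK ?indexg_gt0 // eqxx andbT; apply/asboolP.
  by rewrite inE HDK eqxx iH !andbT HE subsetIl.
apply: leq_trans (subset_leq_card sub) _.
apply: leq_trans (leq_card_bigcup _ _) _.
rewrite expnD; apply: leq_trans (leq_mul leU (leqnn _)).
by rewrite -sum_nat_const leq_sum.
Qed.

From mathcomp Require Import all_classical topology.

Local Open Scope classical_set_scope.

(** * Homomorphisms and inverse limits *)

Section GroupMorph.
Local Open Scope group_scope.
Context (G A : groupType) (f : G -> A).
Hypothesis fM : {morph f : x y / x * y}.

Lemma morph_group1 : f 1 = 1.
Proof. by apply: (@mulgI _ (f 1)); rewrite -fM !mulg1. Qed.

Lemma morph_groupV : {morph f : x / x^-1}.
Proof. by move=> x; apply: (@mulgI _ (f x)); rewrite -fM !mulgV morph_group1. Qed.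

Lemma morph_groupR : {morph f : x y / [~ x, y]}.
Proof. by move=> x y; rewrite !fM !morph_groupV. Qed.

End GroupMorph.

Section InverseLimit.
Local Open Scope group_scope.
Context (G : topologicalGroupType) (S : inverse_system) (phi : G -> isys_prod S).
Hypothesis phiM : forall i x y, phi (x * y) i = (phi x i : isys_group i) * phi y i.
Hypothesis phi_lim : forall x, inverse_limit S (phi x).
Hypothesis phi_open : open = [set phi @^-1` U | U in open].

Lemma limit_coord_open i (c : isys_group i) : open [set x | phi x i = c].
Proof.
rewrite phi_open; exists [set v : isys_prod S | v i = c] => //.
have cv : continuous (fun v : isys_prod S => v i : discrete_topology (isys_group i)).
  exact: proj_continuous.
move/continuousP: cv => /(_ [set c]); apply.
exact: discrete_open.
Qed.

(** By directedness, the sets containing the kernel of some coordinate of the limit form a filter.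
    It converges to [phi 1] coordinate by coordinate, so it contains every neighbourhood of
    [phi 1]. *)
Lemma limit_open1_ker (U : set G) : open U -> U 1 ->
  exists i, forall x, phi x i = 1 :> isys_group i -> U x.
Proof.
rewrite phi_open => -[V oV <-] V1.
pose F : set_system (isys_prod S) := [set B | exists i, forall v,
  inverse_limit S v -> v i = 1 :> isys_group i -> B v].
have FF : Filter F.
  split; first by exists (isys_index0 S).
  - move=> B C [i Bi] [j Cj]; have [k /andP[ik jk]] := isys_directed i j.
    have map1 l (lk : (l <= k)%O) : isys_map lk 1 = 1.
      by apply: morph_group1; apply: gmulfM.
    exists k => v v_lim vk; split.
      by apply: Bi => //; rewrite -(v_lim i k ik) vk map1.
    by apply: Cj => //; rewrite -(v_lim j k jk) vk map1.
  - by move=> B C BC [i Bi]; exists i => v v_lim vi; apply/BC/Bi.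
have cvF : F --> phi 1.
  apply/cvg_sup => i B /= [_ [[W oW <-] W1] WB].
  exists i => v _ vi; apply: WB => /=; move: W1 => /=.
  have -> : phi 1 i = 1 :> isys_group i by apply: morph_group1 (phiM i).
  by rewrite vi.
have [|i Vi] := cvF V; first by apply: open_nbhs_nbhs; split.
by exists i => x xi; apply: Vi.
Qed.

End InverseLimit.

(** * Images in a finite quotient *)

Section FiniteQuotient.
Local Open Scope group_scope.
Context (G : topologicalGroupType) (A : finGroupType) (f : G -> A).
Hypothesis fM : {morph f : x y / x * y}.
Hypothesis f_open : forall a, open [set x | f x = a].
Implicit Types H K M : set G.

Let f1 : f 1 = 1 := morph_group1 fM.
Let fV : {morph f : x / x^-1} := morph_groupV fM.

(** Generation makes this a group for every [H]; on subgroups it is the direct image. *)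
Definition image_group H : {group A} := <<[set a | `[< exists2 x, H x & f x = a >]]%SET>>%G.

Lemma image_groupE H : is_subgroup H ->
  image_group H = [set a | `[< exists2 x, H x & f x = a >]]%SET :> {set A}.
Proof.
move=> [/set_mem H1 HV].
have gS : group_set [set a | `[< exists2 x, H x & f x = a >]]%SET.
  have HM := group_closedM (conj (mem_set H1) HV).
  apply/group_setP; split; first by rewrite !inE; exists 1.
  move=> a b; rewrite !inE => -[x Hx <-] [y Hy <-].
  exists (x * y); last exact: fM.
  by apply/set_mem/HM; apply/mem_set.
exact: gen_set_id.
Qed.

Lemma mem_image_group H a : is_subgroup H ->
  reflect (exists2 x, H x & f x = a) (a \in image_group H).
Proof.
by move=> sH; rewrite image_groupE // finset.inE; apply: (iffP (asboolP _)).
Qed.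

Lemma image_group_ker H x : is_subgroup H -> (forall y, f y = 1 -> H y) ->
  f x \in image_group H -> H x.
Proof.
move=> sH kerH /(mem_image_group _ sH)[y Hy fyx].
rewrite -(mulgKV y x); apply/set_mem/(group_closedM sH); apply/mem_set => //.
by apply: kerH; rewrite fM fV fyx mulgV.
Qed.


Lemma image_group_inj H K : is_subgroup H -> is_subgroup K ->
  (forall y, f y = 1 -> H y) -> (forall y, f y = 1 -> K y) ->
  image_group H = image_group K -> H = K.
Proof.
move=> sH sK kerH kerK eHK; apply/seteqP; split=> x.
  move=> Hx; apply: image_group_ker => //; rewrite -eHK.
  by apply/mem_image_group => //; exists x.
move=> Kx; apply: image_group_ker => //; rewrite eHK.
by apply/mem_image_group => //; exists x.
Qed.

Let sub_setT : is_subgroup [set: G].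
Proof. by split=> [|x y _ _]; apply/mem_set. Qed.

Lemma image_groupS H K : is_subgroup H -> is_subgroup K -> H `<=` K ->
  image_group H \subset image_group K.
Proof.
move=> sH sK HK; apply/fintype.subsetP => a /(mem_image_group _ sH)[x Hx <-].
by apply/mem_image_group => //; exists x => //; apply: HK.
Qed.

(** The fibre of [f] through [x] is open, so it meets [H]. *)
Lemma mem_closure_image H x : closure H x -> exists2 y, H y & f y = f x.
Proof.
move=> /(_ [set y | f y = f x])[|y [Hy Ey]]; last by exists y.
exact: open_nbhs_nbhs.
Qed.

(** By density only the abstract subgroup generated by [s] matters, and the preimage of the
    right-hand side is a subgroup containing [s]. *)
Lemma image_group_topologically_generated (s : seq G) :
  topologically_generated [set` s] = [set: G] :> set G ->
  image_group [set: G] = <<[set f (tnth (in_tuple s) i) | i in 'I_(size s)]%SET>> :> {set A}.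
Proof.
move=> gen_s; apply/eqP; rewrite finset.eqEsubset; apply/andP; split; last first.
  rewrite gen_subG; apply/fintype.subsetP => _ /imsetP[i _ ->].
  by apply/mem_image_group => //; exists (tnth (in_tuple s) i).
pose B := <<[set f (tnth (in_tuple s) i) | i in 'I_(size s)]%SET>>%G.
rewrite -[X in _ \subset X]/(pred_of_set B); apply/fintype.subsetP => _ /(mem_image_group _ sub_setT)[x _ <-].
have : closure (generated_subgroup [set` s]) x by move: gen_s => /= ->.
case/mem_closure_image => y ys <-.
apply: (ys [set z | f z \in B]); split.
  split=> [|u v /set_mem Bu /set_mem Bv]; apply/mem_set; first by rewrite /= f1 group1.
  by rewrite /= fM fV groupM ?groupV.
move=> z sz /=; apply: mem_gen.
have zs : index z s < size s by rewrite index_mem.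
apply/imsetP; exists (Ordinal zs) => //.
by rewrite (tnth_nth z) /= nth_index.
Qed.

Lemma der1_image_group :
  (image_group [set: G])^`(1) \subset image_group (derived_subgroup G).
Proof.
rewrite gen_subG; apply/fintype.subsetP => _ /imset2P[_ _ /(mem_image_group _ sub_setT)[x _ <-]
  /(mem_image_group _ sub_setT)[y _ <-] ->].
apply/mem_image_group; first exact: subgroupP.
exists [~ x, y]; last exact: morph_groupR.
by apply: subset_closure => K [_]; apply; exists x => //; exists y.
Qed.

(** An intermediate [K] is the image of its preimage [N], and [N] is [M] or [G]. *)
Lemma image_group_maximal M : open_maximal_subgroup M ->
  (forall y, f y = 1 -> M y) ->
  maximal (image_group M) (image_group [set: G]).
Proof.
move=> [sM _ MT maxM] kerM; apply/maxgroupP; split.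
  rewrite properE image_groupS //=; apply/negP => /fintype.subsetP sTM.
  apply: MT; apply/seteqP; split=> // x _; apply: image_group_ker => //.
  by apply: sTM; apply/mem_image_group => //; exists x.
move=> K /andP[sKT nTK] sMK.
pose N := [set x | f x \in K].
have sN : is_subgroup N.
  split=> [|u v /set_mem Bu /set_mem Bv]; apply/mem_set; first by rewrite /N /= f1 group1.
  by rewrite /N /= fM fV groupM ?groupV.
have MN : M `<=` N.
  by move=> x Mx; apply: (fintype.subsetP sMK); apply/mem_image_group => //; exists x.
have [NM|NT] := maxM N sN MN; last first.
  case/negP: nTK; apply/fintype.subsetP => _ /(mem_image_group _ sub_setT)[x _ <-].
  by have : N x by rewrite NT.
apply/eqP; rewrite finset.eqEsubset sMK andbT; apply/fintype.subsetP => a Ka.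
have /(mem_image_group _ sub_setT)[x _ xa] := fintype.subsetP sKT a Ka.
apply/mem_image_group => //; exists x => //.
by rewrite -NM /N /= xa.
Qed.

Lemma index_image_group H n : is_subgroup H -> has_index H n ->
  #|image_group [set: G] : image_group H| <= n.
Proof.
move=> sH; rewrite /has_index => /card_esym/card_set_bijP[c [_ _ c_surj]].
pose im (C : set G) := [set a | `[< exists2 x, C x & f x = a >]]%SET.
rewrite -card_lcosets -[X in _ <= X]card_ord -cardsT.
apply: leq_trans (leq_imset_card (fun i : 'I_n => im (c i)) _).
apply/subset_leq_card/fintype.subsetP => _ /lcosetsP[_ /(mem_image_group _ sub_setT)[x _ <-] ->].
have [|i ltin ci] := c_surj [set x * h | h in H]; first by exists x.
apply/imsetP; exists (Ordinal ltin) => //; apply/setP => a.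
rewrite ci finset.inE; apply/lcosetP/asboolP.
  by move=> [_ /(mem_image_group _ sH)[h Hh <-] ->]; exists (x * h) => //; exists h.
move=> [_ [h Hh <-] <-]; exists (f h) => //.
by apply/mem_image_group => //; exists h.
Qed.

(** The intersection survives because every member of [F] contains the kernel of [f]. *)
Lemma image_group_bigcap (F : set (set G)) H : is_subgroup H ->
  F `<=` @open_maximal_subgroup G -> H = \bigcap_(M in F) M ->
  (forall y, f y = 1 -> H y) ->
  exists2 F' : seq {group A},
    {in F', forall M : {group A}, maximal M (image_group [set: G])} &
    image_group H = (image_group [set: G] :&: \bigcap_(M <- F') M)%SET :> {set A}.
Proof.
move=> sH maxF HE kerH.
have kerM M : F M -> forall y, f y = 1 -> M y.
  by move=> FM y fy; have := kerH y fy; rewrite HE; apply.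
(* [F] may be infinite, but its members have finitely many images. *)
pose F' := [seq M' <- enum {group A} | `[< exists2 M, F M & image_group M = M' >]].
exists F' => [M'|].
  rewrite mem_filter => /andP[/asboolP[M FM <-] _].
  by apply: image_group_maximal; [apply: maxF|apply: kerM].
apply/setP => a; rewrite finset.inE; apply/idP/andP.
  move=> /(mem_image_group _ sH)[x Hx <-]; split.
    by apply/mem_image_group => //; exists x.
  rewrite big_seq; apply: (big_ind (fun B : {set A} => f x \in B)).
  - by rewrite finset.inE.
  - by move=> B C fB fC; rewrite finset.inE fB.
  move=> M'; rewrite mem_filter => /andP[/asboolP[M FM <-] _].
  have [sM _ _ _] := maxF M FM.
  by apply/mem_image_group => //; exists x => //; move: Hx; rewrite HE; apply.
move=> [/(mem_image_group _ sub_setT)[x _ <-] xF'].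
apply/mem_image_group => //; exists x => //; rewrite HE => M FM.
have [sM _ _ _] := maxF M FM.
apply: (image_group_ker sM (kerM M FM)).
have F'M : image_group M \in F'.
  by rewrite mem_filter mem_enum andbT; apply/asboolP; exists M.
have uF' : uniq F' := filter_uniq _ (enum_uniq _).
by move: xF'; rewrite (bigD1_seq _ F'M uF') /= finset.inE => /andP[].
Qed.

End FiniteQuotient.

(** * Nilpotent finite images *)

Lemma nilpotent_image_pronilpotent (T : topologicalGroupType) (A : finGroupType)
    (h : T -> A) :
  {morph h : x y / (x * y)%g} -> open [set x | h x = 1%g] -> pronilpotent T ->
  nilpotent (image_group h [set: T]).
Proof.
move=> hM h_open [S [nilS [psi [psiM psi_bij psi_open]]]].
have psi_lim x : inverse_limit S (psi x) by have [psi_fun _ _] := psi_bij; apply: psi_fun.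
(* Some coordinate, with nilpotent target, has its kernel inside that of [h]; so [h] factors through
   it. *)
have [|j jP] := limit_open1_ker psiM psi_lim psi_open h_open.
  exact: morph_group1.
pose p x : isys_group j := psi x j; have pM : {morph p : x y / (x * y)%g} := psiM j.
have sT : is_subgroup [set: T] by split=> [|x y _ _]; apply/mem_set.
(* The value does not depend on the preimage chosen, and the default [1] is met only off the image
   of [p]. *)
pose m b := h (xget 1%g [set x | p x = b]).
have mE x : m (p x) = h x.
  rewrite /m; case: xgetP => [y _ /= pyx|/(_ x)]; last by case.
  apply/divg1_eq; rewrite -(morph_groupV hM) -hM; apply: jP.
  by rewrite -[LHS]/(p (y * x^-1)%g) pM (morph_groupV pM) pyx mulgV.
have mM : {in image_group p [set: T] &, {morph m : a b / (a * b)%g}}.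
  move=> _ _ /(mem_image_group pM _ sT)[x _ <-] /(mem_image_group pM _ sT)[y _ <-].
  by rewrite -pM !mE hM.
have nilB : nilpotent (image_group p [set: T]).
  by apply: nilpotentS (nilS j); apply: finset.subsetT.
have := morphim_nil (Morphism mM) nilB; apply: nilpotentS.
apply/fintype.subsetP => _ /(mem_image_group hM _ sT)[x _ <-].
apply/morphimP; exists (p x); rewrite ?mE //; apply/(mem_image_group pM _ sT); by exists x.
Qed.

Lemma nilpotent_image_subgroup (G : topologicalGroupType) (A : finGroupType)
    (f : G -> A) (H : subgroup G) :
  {morph f : x y / (x * y)%g} -> open [set x | f x = 1%g] ->
  pronilpotent (subgroup_type H) -> nilpotent (image_group f H).
Proof.
move=> fM f_open nilH; pose h (x : subgroup_type H) := f (\val x).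
have hM : {morph h : x y / (x * y)%g} by move=> x y; apply: fM.
have h_open : open [set x | h x = 1%g].
  have cv : continuous (fun x : subgroup_type H => \val x : G).
    exact: initial_continuous.
  by move/continuousP: cv => /(_ _ f_open).
have := nilpotent_image_pronilpotent hM h_open nilH; apply: nilpotentS.
apply/fintype.subsetP => _ /(mem_image_group fM _ (subgroupP H))[x Hx <-].
apply/(mem_image_group hM); first by split=> [|u v _ _]; apply/mem_set.
by exists (exist _ x (mem_set Hx) : subgroup_type H).
Qed.

(** * From finite quotients to [G] *)

Lemma card_leNgt T (B : set T) m :
  ~~ (B #<= `I_m)%card -> (`I_m.+1 #<= B)%card.
Proof.
have [/finite_setP[k Bk]|/infiniteP infB] := pselect (finite_set B).
  rewrite (card_le_eql Bk) (card_le_eqr Bk) !card_le_II; by rewrite -ltnNge.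
by move=> _; apply: card_le_trans infB; apply: subset_card_le.
Qed.

Local Open Scope card_scope.

Theorem corollary12 (G : topologicalGroupType)
    (G_fg : topologically_finitely_generated G)
    (G_prosolvable : prosolvable G)
    (G'_pronilpotent : pronilpotent (subgroup_type (derived_subgroup G))) :
  exists beta : nat, forall n : nat, (0 < n)%N ->
    c_subgroups G n #<= `I_(n ^ beta)%N.
Proof.
have [X [/finite_seqP[s ->] gen_s]] := G_fg.
exists (growth_exponent (size s)) => n n_gt0; apply/negPn/negP => /card_leNgt.
(* If the bound failed, [e] would list [m.+1] distinct members of [c_subgroups G n]. *)
set m := n ^ _ => /pcard_leP/unsquash e.
have [S [_ [phi [phiM phi_bij phi_open]]]] := G_prosolvable.
have phi_lim x : inverse_limit S (phi x) by have [phi_fun _ _] := phi_bij; apply: phi_fun.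
have e_c i : (i < m.+1)%N -> c_subgroups G n (e i) by move=> ?; apply: 'funS_e.
(* The intersection of these finitely many open subgroups is open, so it contains the kernel of one
   coordinate of [phi]. *)
have [k kP] : exists k, forall x, phi x k = 1%g :> isys_group k ->
    (\bigcap_(i in `I_m.+1) e i) x.
  apply: limit_open1_ker => //.
    rewrite bigcap_mkord; apply: big_ind; [exact: openT|exact: openI|].
    by move=> i _; have [] := e_c i (ltn_ord i).
  move=> i im; have [[/set_mem H1 _] _ _ _] := e_c i im; exact: H1.
pose f x : isys_group k := phi x k; have fM : {morph f : x y / (x * y)%g} := phiM k.
have f_open a : open [set x | f x = a] by apply: limit_coord_open.
pose Q := image_group f [set: G].
have nilQ' : nilpotent Q^`(1)%g.
  apply: nilpotentS (der1_image_group fM) _.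
  exact: nilpotent_image_subgroup.
pose N := [set image_group f (e i) | i : 'I_m.+1]%SET.
have : #|N| <= m.
  apply: (card_maximal_intersections (image_group_topologically_generated fM f_open gen_s) nilQ').
  move=> _ /imsetP[i _ ->]; have [sH _ iH [F [maxF HE]]] := e_c i (ltn_ord i).
  split; first exact: index_image_group.
  apply: image_group_bigcap maxF HE _ => //.
  by move=> y fy; apply: kP y fy i (ltn_ord i).
(* Subgroups containing the kernel are determined by their images, so [N] has [m.+1] elements, a
   contradiction. *)
rewrite card_imset ?card_ord ?ltnn // => i j.
have [sH _ _ _] := e_c i (ltn_ord i); have [sK _ _ _] := e_c j (ltn_ord j).
move/(image_group_inj fM sH sK) => eij; apply: val_inj.
apply: ('inj_e); rewrite ?inE /=; try exact: ltn_ord.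
by apply: eij => y fy; [apply: kP y fy i (ltn_ord i)|apply: kP y fy j (ltn_ord j)].
Qed.
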